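(* Let $\mathcal F$ be the feasible region of the mathematical program with switching constraints (MPSC) $$\min f(z)\quad\text{s.t.}\quad g(z)\le 0,\ h(z)=0,\ G_i(z)H_i(z)=0,\ i=1,\dots,m.$$ If $z^*\in\mathcal F$ satisfies MPSC piecewise CRSC, then the MPSC local error bound holds in a neighborhood of $z^*$, i.e. there exist a neighborhood $V(z^* )$ of $z^*$ and $\alpha>0$ such that $$\operatorname{dist}_{\mathcal F}(z)\le\alpha\left(\sum_{i=1}^p\max\{g_i(z),0\}+\sum_{j=1}^q|h_j(z)|+\sum_{i=1}^m\min\{|G_i(z)|,|H_i(z)|\}\right)\quad\forall z\in V(z^* ).$$
   Context: Setting: $f:\mathbb R^n\to\mathbb R$, $g:\mathbb R^n\to\mathbb R^p$, $h:\mathbb R^n\to\mathbb R^q$, $G_i,H_i:\mathbb R^n\to\mathbb R$ ($i=1,\dots,m$) are continuously differentiable. $\operatorname{dist}_{\mathcal F}(z)$ is the distance from $z$ to $\mathcal F$ with respect to an arbitrary norm on $\mathbb R^n$. Index sets at $z^*\in\mathcal F$: $\mathcal I_G^*=\{i: G_i(z^* )=0,H_i(z^* )\ne0\}$; $\mathcal I_H^*=\{i: G_i(z^* )\neq0,H_i(z^* )=0\}$; $\mathcal I_{GH}^*=\{i: G_i(z^* )=H_i(z^* )=0\}$. $\mathcal P(\mathcal I_{GH}^* )$ is the set of all pairs $(\beta_1,\beta_2)$ of disjoint (possibly empty) sets with $\beta_1\cup\beta_2=\mathcal I_{GH}^*$. For $(\beta_1,\beta_2)\in\mathcal P(\mathcal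 I_{GH}^* )$, $\mathrm{NLP}(\beta_1,\beta_2)$ is the nonlinear program $$\min f(z)\ \text{ s.t. }\ g(z)\le0,\ h(z)=0,\ G_i(z)=0\ (i\in\mathcal I_G^*\cup\beta_1),\ H_i(z)=0\ (i\in\mathcal I_H^*\cup\beta_2).$$ CRSC (constant rank of subspace component): for a nonlinear program with constraints $\tilde g_i(z)\le0$ ($i=1,\dots,\tilde p$), $\tilde h_j(z)=0$ ($j=1,\dots,\tilde q$) and a feasible point $\bar z$ with active set $\bar{\mathcal I}=\{i:\tilde g_i(\bar z)=0\}$, let $$\mathcal I^-=\Big\{l\in\bar{\mathcal I}: -\nabla\tilde g_l(\bar z)=\sum_{j=1}^{\tilde q}\lambda_j\nabla\tilde h_j(\bar z)+\sum_{i\in\bar{\mathcal I}\setminus\{l\}}\mu_i\nabla\tilde g_i(\bar z)\ \text{for some }\lambda_j\in\mathbb R,\ \mu_i\ge0\Big\}.$$ CRSC holds at $\bar z$ if there is a neighborhood $N(\bar z)$ on which the rank of $\{\nabla\tilde g_i(z)\}_{i\in\mathcal I^-}\cup\{\nabla\tilde h_j(z)\}_{j=1}^{\tilde q}$ is constant. MPSC piecewise CRSC at $z^*$: for every $(\beta_1,\beta_2)\in\mathcal P(\mathcal I_{GH}^* )$, CRSC holds for $\mathrm{NLP}(\beta_1,\beta_2)$ at $z^*$. *)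

(* Defs.v *)
From HB Require Import structures.
From mathcomp Require Import all_boot all_order all_algebra.
From mathcomp Require Import all_classical all_reals all_analysis.
Import Order.TTheory GRing.Theory Num.Theory.
Import numFieldNormedType.Exports.

Set Implicit Arguments.
Unset Strict Implicit.
Unset Printing Implicit Defensive.

Local Open Scope ring_scope.

Section Calculus.
Context {R : realType} {n : nat}.

Definition continuously_differentiable {W : normedModType R}
    (f : 'rV[R]_n -> W) : Prop :=
  (forall z, differentiable f z) /\
  (forall j : 'I_n, continuous (fun z => 'D_(delta_mx 0 j) f z)).

Definition gradient (f : 'rV[R]_n -> R) (z : 'rV[R]_n) : 'rV[R]_n :=
  \row_j 'D_(delta_mx 0 j) f z.

Record is_norm (N : 'rV[R]_n -> R) : Prop := IsNorm {
  norm_triangle : forall x y, N (x + y) <= N x + N y;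
  norm_homogeneous : forall a x, N (a *: x) = `|a| * N x;
  norm_definite : forall x, N x = 0 -> x = 0 }.

(* [inf] is the genuine infimum only when [F] is nonempty. *)
Definition dist (N : 'rV[R]_n -> R) (F : set 'rV[R]_n) (z : 'rV[R]_n) : R :=
  inf [set N (z - w) | w in F]%classic.

End Calculus.

Section NonlinearProgram.
Context {R : realType} {n : nat}.

(* min nlp_obj(z) s.t. nlp_ineq i z <= 0 for all i, nlp_eq j z = 0 for all j.
   The constraints are indexed by arbitrary finite types, so that families
   indexed by subsets need no renumbering. *)
Record nlp := NLP {
  nlp_obj : 'rV[R]_n -> R;
  nlp_ineq_idx : finType;
  nlp_ineq : nlp_ineq_idx -> 'rV[R]_n -> R;
  nlp_eq_idx : finType;
  nlp_eq : nlp_eq_idx -> 'rV[R]_n -> R }.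

Definition active (P : nlp) (z : 'rV[R]_n) : {set nlp_ineq_idx P} :=
  [set i | nlp_ineq i z == 0].

Definition active_minus (P : nlp) (z : 'rV[R]_n) : {set nlp_ineq_idx P} :=
  [set l in active P z |
    `[< exists (lambda : nlp_eq_idx P -> R) (mu : nlp_ineq_idx P -> R),
          (forall i, i \in active P z :\ l -> 0 <= mu i) /\
          - gradient (nlp_ineq l) z =
            \sum_(j : nlp_eq_idx P) lambda j *: gradient (nlp_eq j) z +
            \sum_(i in active P z :\ l) mu i *: gradient (nlp_ineq i) z >]].

Definition gradient_rank (P : nlp) (S : {set nlp_ineq_idx P})
    (z : 'rV[R]_n) : nat :=
  (\dim <<[seq gradient (nlp_ineq i) z | i in S] ++
          [seq gradient (nlp_eq j) z | j : nlp_eq_idx P]>>)%VS.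

(* The index set is frozen at [zbar]; only the gradients move with [z]. *)
Definition crsc (P : nlp) (zbar : 'rV[R]_n) : Prop :=
  exists r : nat,
    \forall z \near zbar, gradient_rank (active_minus P zbar) z = r.

End NonlinearProgram.
Arguments nlp : clear implicits.

Section SwitchingConstraints.
Context {R : realType} {n p q m : nat}.

(* min f(z) s.t. g(z) <= 0, h(z) = 0, G_i(z) H_i(z) = 0 *)
Record mpsc := MPSC {
  mpsc_f : 'rV[R]_n -> R;
  mpsc_g : 'rV[R]_n -> 'rV[R]_p;
  mpsc_h : 'rV[R]_n -> 'rV[R]_q;
  mpsc_G : 'I_m -> 'rV[R]_n -> R;
  mpsc_H : 'I_m -> 'rV[R]_n -> R }.

Variable P : mpsc.

Definition mpsc_continuously_differentiable : Prop :=
  [/\ continuously_differentiable (mpsc_f P),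
      continuously_differentiable (mpsc_g P),
      continuously_differentiable (mpsc_h P),
      forall i, continuously_differentiable (mpsc_G P i) &
      forall i, continuously_differentiable (mpsc_H P i)].

Definition mpsc_feasible : set 'rV[R]_n :=
  [set z | [/\ forall i, mpsc_g P z 0 i <= 0,
               forall j, mpsc_h P z 0 j = 0 &
               forall i, mpsc_G P i z * mpsc_H P i z = 0]]%classic.

Definition I_G (z : 'rV[R]_n) : {set 'I_m} :=
  [set i | (mpsc_G P i z == 0) && (mpsc_H P i z != 0)].
Definition I_H (z : 'rV[R]_n) : {set 'I_m} :=
  [set i | (mpsc_G P i z != 0) && (mpsc_H P i z == 0)].
Definition I_GH (z : 'rV[R]_n) : {set 'I_m} :=
  [set i | (mpsc_G P i z == 0) && (mpsc_H P i z == 0)].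

Definition bipartitions (A : {set 'I_m}) : {set {set 'I_m} * {set 'I_m}} :=
  [set b : {set 'I_m} * {set 'I_m} | [disjoint b.1 & b.2] && (b.1 :|: b.2 == A)].

(* NLP(beta1, beta2) at [zstar]: the equality constraints are h together with
   G_i for i in I_G u beta1 and H_i for i in I_H u beta2. *)
Definition branch_nlp (zstar : 'rV[R]_n) (beta1 beta2 : {set 'I_m}) : nlp R n :=
  @NLP R n (mpsc_f P)
    'I_p (fun i z => mpsc_g P z 0 i)
    ('I_q + ({i | i \in I_G zstar :|: beta1} +
             {i | i \in I_H zstar :|: beta2}))%type
    (fun k z => match k with
                | inl j => mpsc_h P z 0 j
                | inr (inl i) => mpsc_G P (val i) z
                | inr (inr i) => mpsc_H P (val i) z
                end).

Definition mpsc_piecewise_crsc (zstar : 'rV[R]_n) : Prop :=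
  forall beta1 beta2 : {set 'I_m},
    (beta1, beta2) \in bipartitions (I_GH zstar) ->
    crsc (branch_nlp zstar beta1 beta2) zstar.

Definition mpsc_local_error_bound (N : 'rV[R]_n -> R) (zstar : 'rV[R]_n) : Prop :=
  exists alpha : R, 0 < alpha /\
    \forall z \near zstar,
      dist N mpsc_feasible z <=
      alpha * (\sum_(i < p) Num.max (mpsc_g P z 0 i) 0 +
               \sum_(j < q) `|mpsc_h P z 0 j| +
               \sum_(i < m) Num.min `|mpsc_G P i z| `|mpsc_H P i z|).

End SwitchingConstraints.
Arguments mpsc : clear implicits.

(* Main.v *)
(* CRSC gives an error bound for each branch NLP. Constancy of the rank of the
   gradients of the constraints in I^- and of the equalities makes all of them
   vanish, near z*, wherever a subfamily F_B with independent gradients does.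
   Positive dependence of the gradients in I^- makes |F_B| bounded by the
   violation of those constraints: the balancing combination has zero gradient at
   z* and vanishes on {F_B = 0}, so it is o(|F_B|). The remaining active
   inequalities satisfy MFCQ relative to {F_B = 0}, which gives a nearby feasible
   point by descent of the total violation. A point z is compared with the branch
   in which each biactive pair drops its larger member at z. *)
Require Import Defs.
From mathcomp Require Import all_boot all_order all_algebra.
From mathcomp Require Import all_classical all_reals all_analysis.
From mathcomp Require Import ring lra.
Import Order.TTheory GRing.Theory Num.Theory.
Import numFieldNormedType.Exports.
Set Implicit Arguments.
Unset Strict Implicit.
Unset Printing Implicit Defensive.
Local Open Scope classical_set_scope.
Local Open Scope ring_scope.

(** No implicit function theorem is used: nearby points come as minimisers over compact sets,
    contradicted by any strict improvement. Independence of gradients is carried by a dual family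
    [t], which survives perturbation and also supplies the correcting directions. The delicate point
    is a circularity. The corrected point w satisfies |w - z| <= C (|F_B(z)| + violation), but
    |F_B(z)| is itself only bounded by a multiple of violation + e |w - z|. The loop closes by
    absorption: C is fixed first, then e small against C, and only then the neighbourhood in which w
    must lie. This dictates the order of quantifiers in [mfcq_error_bound]. *)

Section Calculus.
Context {R : realType} {n : nat}.
Implicit Types (x y z u v w d : 'rV[R]_n) (F : 'rV[R]_n -> R).

Definition dot x y : R := \sum_(j < n) x 0 j * y 0 j.

Lemma dotC x y : dot x y = dot y x.
Proof. by apply: eq_bigr => j _; rewrite mulrC. Qed.

Lemma dotDr x y z : dot x (y + z) = dot x y + dot x z.
Proof. by rewrite -big_split; apply: eq_bigr => j _; rewrite mxE mulrDr. Qed.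

Lemma dotZr a x y : dot x (a *: y) = a * dot x y.
Proof. by rewrite mulr_sumr; apply: eq_bigr => j _; rewrite mxE mulrCA. Qed.

Lemma dotNr x y : dot x (- y) = - dot x y.
Proof. by rewrite -scaleN1r dotZr mulN1r. Qed.

Lemma dot0r x : dot x 0 = 0.
Proof. by rewrite -(scale0r 0) dotZr mul0r. Qed.

Lemma dot_sumr x (I : Type) (r : seq I) (Q : pred I) (f : I -> 'rV[R]_n) :
  dot x (\sum_(i <- r | Q i) f i) = \sum_(i <- r | Q i) dot x (f i).
Proof.
by elim/big_rec2: _ => [|i y1 y2 _ <-]; rewrite ?dot0r ?dotDr.
Qed.

Lemma dotDl x y z : dot (x + y) z = dot x z + dot y z.
Proof. by rewrite dotC dotDr !(dotC z). Qed.

Lemma dotNl x y : dot (- x) y = - dot x y.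
Proof. by rewrite dotC dotNr dotC. Qed.

Lemma dotZl a x y : dot (a *: x) y = a * dot x y.
Proof. by rewrite dotC dotZr dotC. Qed.

Lemma dot_suml x (I : Type) (r : seq I) (Q : pred I) (f : I -> 'rV[R]_n) :
  dot (\sum_(i <- r | Q i) f i) x = \sum_(i <- r | Q i) dot (f i) x.
Proof. by rewrite dotC dot_sumr; apply: eq_bigr => i _; rewrite dotC. Qed.

Lemma coord_le_norm x (j : 'I_n) : `|x 0 j| <= `|x|.
Proof.
rewrite -[leRHS]/(mx_norm x) mx_normrE; apply/bigmax_geP; right => /=.
by exists (0, j).
Qed.

Lemma dot_le x y : `|dot x y| <= (\sum_(j < n) `|x 0 j|) * `|y|.
Proof.
apply: le_trans (ler_norm_sum _ _ _) _; rewrite mulr_suml.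
by apply: ler_sum => j _; rewrite normrM ler_wpM2l// coord_le_norm.
Qed.

Lemma dot_continuous y : continuous (fun x => dot x y).
Proof.
apply: continuous_big => [|j _]; first exact: add_continuous.
by move=> x; apply: continuousM; [exact: coord_continuous|exact: cst_continuous].
Qed.

Lemma near_normP (Q : 'rV[R]_n -> Prop) z :
  (\forall x \near z, Q x) <->
  exists2 d : R, 0 < d & forall x, `|x - z| < d -> Q x.
Proof.
split=> [/nbhs_normP[d d0 dQ]|[d d0 dQ]].
  by exists d => // x xz; apply: dQ => /=; rewrite distrC.
by apply/nbhs_normP; exists d => // x /= xz; apply: dQ; rewrite distrC.
Qed.

Lemma near_forall (I : finType) (Q : I -> 'rV[R]_n -> Prop) z :
  (forall i, \forall x \near z, Q i x) -> \forall x \near z, forall i, Q i x.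
Proof. move=> zQ; exact: (@filter_forall _ _ Q (nbhs z) _ zQ). Qed.

Lemma derive_dot F z d : differentiable F z -> 'D_d F z = dot (gradient F z) d.
Proof.
move=> dF; rewrite deriveE// {1}(row_sum_delta d) linear_sum.
by apply: eq_bigr => j _; rewrite linearZ mxE deriveE//= mulrC.
Qed.

Lemma mean_value F u v : (forall z, differentiable F z) ->
  exists2 s : R, 0 <= s <= 1 &
    F u - F v = dot (gradient F (v + s *: (u - v))) (u - v).
Proof.
move=> dF; pose l (s : R) := v + s *: (u - v).
have dl (s : R) : differentiable l s.
  by apply: differentiableD => //; apply: differentiableZl.
have dFl (s : R) : differentiable (F \o l) s by apply: differentiable_comp.
have Fl (s : R) : is_derive s 1 (F \o l) (dot (gradient F (l s)) (u - v)).
  apply: DeriveDef; first exact: diff_derivable.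
  rewrite deriveE// diff_comp//= -derive_dot// deriveE//; congr ('d F _ _).
  rewrite -deriveE// /l deriveD//; last exact: diff_derivable.
  rewrite derive_cst add0r deriveE; last exact: differentiableZl.
  by rewrite diffZl//= diff_val scale1r.
have [|s s01] := @MVT_segment R (F \o l) _ 0 1 ler01 (fun s _ => Fl s).
  by apply: continuous_subspaceT => s; exact: differentiable_continuous.
rewrite /l/= scale1r subrKC scale0r addr0 subr0 mulr1 => ->.
by exists s => //; move: s01; rewrite in_itv.
Qed.

Lemma C1_continuous F : continuously_differentiable F -> continuous F.
Proof. by move=> [dF _] x; exact: differentiable_continuous. Qed.

(** Strict differentiability: both points vary, because the later steps compare two points neither
    of which need be [z]. The mean value point stays in the ball around [z], where the gradient is
    close to its value at [z]. *)
Lemma C1_strict F z e : continuously_differentiable F -> 0 < e ->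
  exists2 d : R, 0 < d & forall u v, `|u - z| < d -> `|v - z| < d ->
    `|F u - F v - dot (gradient F z) (u - v)| <= e * `|u - v|.
Proof.
move=> [dF cF] e0.
have n1 : 0 < n%:R + 1 :> R by rewrite ltr_wpDl.
have /near_normP[d d0 dG] : \forall x \near z, forall j : 'I_n,
    `|gradient F z 0 j - gradient F x 0 j| < e / (n%:R + 1).
  apply: near_forall => j.
  move/cvgr_dist_lt: (cF j z) => /(_ (e / (n%:R + 1)) (divr_gt0 e0 n1)).
  by apply: filterS => x; rewrite !mxE.
exists d => // u v uz vz; have [s /andP[s0 s1] ->] := mean_value u v dF.
set x := v + _; rewrite -dotNl -dotDl.
have xz : `|x - z| < d.
  have -> : x - z = s *: (u - z) + (1 - s) *: (v - z).
    by apply/rowP => j; rewrite !mxE; ring.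
  apply: le_lt_trans (ler_normD _ _) _; rewrite !normrZ ger0_norm//.
  rewrite (@ger0_norm _ (1 - s)) ?subr_ge0//.
  have [->|sn0] := eqVneq s 0; first by rewrite mul0r subr0 mul1r add0r.
  have sgt0 : 0 < s by rewrite lt_def sn0.
  rewrite (_ : d = s * d + (1 - s) * d); last by ring.
  by apply: ltr_leD; [rewrite ltr_pM2l|rewrite ler_wpM2l ?subr_ge0// ltW].
apply: le_trans (dot_le _ _) _; rewrite ler_wpM2r//.
apply: (@le_trans _ _ (\sum_(j < n) e / (n%:R + 1))).
  by apply: ler_sum => j _; rewrite [X in `|X|]mxE [X in _ + X]mxE distrC ltW// dG.
rewrite sumr_const card_ord -[leLHS]mulr_natr mulrAC ler_pdivrMr//.
by rewrite ler_pM2l// lerDl.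
Qed.

End Calculus.

(** * Zeros of a residual by minimisation of a perturbed residual *)

Section Descent.
Context {R : realType} {n : nat}.
Implicit Types (z u v w x : 'rV[R]_n) (phi : 'rV[R]_n -> R).

Lemma norm_sub_continuous z : continuous (fun x => `|x - z|).
Proof.
move=> x; apply: (@continuous_comp _ _ _ (fun x => x - z) (fun x => `|x|)).
  by apply: (@continuousB _ _ _ id (cst z) x) => //; exact: cst_continuous.
exact: norm_continuous.
Qed.

Lemma closed_bounded_min phi (S : set 'rV[R]_n) z (r : R) x0 :
  continuous phi -> closed S -> (forall x, S x -> `|x - z| <= r) -> S x0 ->
  exists2 u, S u & forall x, S x -> phi u <= phi x.
Proof.
move=> cphi clS Sr Sx0.
have cS : compact S.
  apply: bounded_closed_compact => //; exists (r + `|z|); split => [|M ltM x Sx].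
    by rewrite num_real.
  apply: le_trans (ltW ltM); rewrite -{1}(subrK z x) (le_trans (ler_normD _ _))//.
  by rewrite lerD2r Sr.
have [||u Su umin] := @compact_EVT_min _ R phi S _ cS; first by exists x0.
  exact: continuous_subspaceT.
exists u => [|x Sx]; first by rewrite inE in Su.
by apply: umin; rewrite inE.
Qed.

(** An Ekeland-type argument: minimise phi + (c/2) |. - z| over a closed ball. If phi were positive
    at the minimiser, a descent step of rate c would gain twice the penalty it can add. Comparing
    the minimiser with z itself gives the distance estimate. *)
Lemma descent_to_zero phi z0 (c r : R) :
    continuous phi -> (forall x, 0 <= phi x) -> phi z0 = 0 -> 0 < c -> 0 < r ->
    (forall u, `|u - z0| < r -> 0 < phi u ->
      exists2 v, phi v < phi u & phi v + c * `|v - u| <= phi u) ->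
  \forall z \near z0, exists w,
    [/\ phi w = 0, `|w - z0| < r & `|w - z| <= 2 / c * phi z].
Proof.
move=> cphi phi0 phiz0 c0 r0 descent.
(* The fractions keep the descent step in the ball of radius r/2: |z - z0| < r/4, |u - z| <= r/8 and
   |v - u| <= r/16. *)
have near_phi : \forall z \near z0, `|phi z0 - phi z| < c * r / 16.
  by move/cvgr_dist_lt: (cphi z0); apply; rewrite divr_gt0 ?mulr_gt0.
have /near_normP[d d0 dphi] := near_phi.
apply/near_normP; exists (Num.min d (r / 4)); first by rewrite lt_min d0 divr_gt0.
move=> z; rewrite lt_min => /andP[/dphi phiz zr].
rewrite phiz0 sub0r normrN ger0_norm// in phiz.
pose psi x := phi x + c / 2 * `|x - z|.
have cpsi : continuous psi.
  move=> x; apply: (@continuousD _ _ _ phi (fun x => c / 2 * `|x - z|) x).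
    exact: cphi.
  apply: (@continuousM _ _ (cst (c / 2)) (fun x => `|x - z|) x).
    exact: cst_continuous.
  exact: norm_sub_continuous.
pose S := [set x | `|x - z0| <= r / 2].
have clS : closed S.
  apply: (@closed_comp _ _ (fun x => `|x - z0|) [set y | y <= r / 2]).
    by move=> x _; exact: norm_sub_continuous.
  exact: closed_le.
have Sz : S z by rewrite /S/=; lra.
have [u Su umin] := closed_bounded_min cpsi clS (fun=> id) Sz.
have uz : phi u + c / 2 * `|u - z| <= phi z.
  by have := umin _ Sz; rewrite /psi subrr normr0 mulr0 addr0.
have cuz : 0 <= c / 2 * `|u - z| by rewrite mulr_ge0// divr_ge0 ?ltW.
exists u; split; last first.
- by rewrite mulrAC ler_pdivlMr// mulrC; have := phi0 u; lra.
- by have h : `|u - z0| <= r / 2 := Su; lra.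
apply/eqP; rewrite eq_le phi0 andbT leNgt; apply/negP => phiu.
have uzr : `|u - z| <= r / 8.
  by rewrite -(@ler_pM2l _ (c / 2)) ?divr_gt0//; lra.
have uz0 : `|u - z0| <= 3 / 8 * r.
  by rewrite -(subrK z u) -addrA (le_trans (ler_normD _ _))//; lra.
have [|v phiv vu] := descent u _ phiu; first lra.
have vur : `|v - u| <= r / 16.
  by rewrite -(@ler_pM2l _ c)//; have := phi0 v; lra.
have Sv : S v.
  by rewrite /S/= -(subrK u v) -addrA (le_trans (ler_normD _ _))//; lra.
have := umin _ Sv; rewrite /psi.
have : `|v - z| <= `|v - u| + `|u - z| by rewrite -{1}(subrK u v) -addrA ler_normD.
rewrite -(@ler_pM2l _ (c / 2)) ?divr_gt0// mulrDr => vz.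
have := normr_ge0 (v - u); rewrite -(@ler_pM2l _ c)// mulr0; lra.
Qed.

End Descent.

(** * Error bound under MFCQ relative to independent equalities *)

Section Regularity.
Context {R : realType} {n : nat}.

Lemma uniform_radius (I : finType) (Q : I -> R -> Prop) :
    (forall i (a b : R), 0 < b <= a -> Q i a -> Q i b) ->
    (forall i, exists2 a, 0 < a & Q i a) ->
  exists2 a, 0 < a & forall i, Q i a.
Proof.
move=> Qle ex; have {ex}/choice[a aQ] : forall i, exists a : R, 0 < a /\ Q i a.
  by move=> i; have [a] := ex i; exists a.
have a0 : 0 < \big[Order.min/1]_i a i.
  by apply: lt_bigmin => [|i _]; [exact: ltr01|have [] := aQ i].
exists (\big[Order.min/1]_i a i) => // i; have [_] := aQ i; apply: Qle.
by rewrite a0 /=; exact: bigmin_le.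
Qed.

Lemma C1_strict_family (I : finType) (F : I -> 'rV[R]_n -> R) z (e : R) :
    (forall i, continuously_differentiable (F i)) -> 0 < e ->
  exists2 d : R, 0 < d & forall i u v, `|u - z| < d -> `|v - z| < d ->
    `|F i u - F i v - dot (gradient (F i) z) (u - v)| <= e * `|u - v|.
Proof.
move=> C1 e0; apply: uniform_radius => [i a b /andP[_ ba] Pa u v ub vb|i].
  by apply: Pa; exact: lt_le_trans ba.
exact: C1_strict.
Qed.

(** Only one positive term is guaranteed, so the gain [s] counts once, whereas the error [h] is paid
    by every term. *)
Lemma sumr_decrease (K : finType) (p q : K -> R) (s h : R) :
    (forall k, 0 <= p k) -> 0 < \sum_k p k -> 0 <= s ->
    (forall k, q k <= p k - s * (0 < p k)%R%:R + h) ->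
  \sum_k q k <= \sum_k p k - s + #|K|%:R * h.
Proof.
move=> p0 sp s0 qp.
have [||k /= pk] := @psumr_neq0P _ _ xpredT p; [by []|by apply/eqP; rewrite gt_eqF|].
apply: le_trans (ler_sum _ (fun k _ => qp k)) _.
rewrite !big_split/= sumr_const mulr_natl lerD2r lerD2l sumrN lerN2.
rewrite -mulr_sumr ler_peMr// (bigD1 k)//= pk lerDl sumr_ge0//.
Qed.

(* Moving in the direction [- \sum_b sgr (F b u) *: t b + K *: d0] with [K]
   large decreases every nonzero |F b| and every positive g i at unit rate to
   first order, while |F b| grows at most by o(1) where it vanishes. *)
Lemma mfcq_error_bound (B I : finType) (Q : pred I) (F : B -> 'rV[R]_n -> R)
    (g : I -> 'rV[R]_n -> R) (z0 : 'rV[R]_n) (t : B -> 'rV[R]_n) d0 :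
    (forall b, continuously_differentiable (F b)) ->
    (forall i, continuously_differentiable (g i)) ->
    (forall b, F b z0 = 0) -> (forall i, Q i -> g i z0 <= 0) ->
    (forall b c, dot (gradient (F b) z0) (t c) = (b == c)%:R) ->
    (forall b, dot (gradient (F b) z0) d0 = 0) ->
    (forall i, Q i -> dot (gradient (g i) z0) d0 <= - 1) ->
  exists2 C : R, 0 < C & forall U : 'rV[R]_n -> Prop,
    (\forall z \near z0, U z) -> \forall z \near z0,
    exists w, [/\ U w, forall b, F b w = 0, forall i, Q i -> g i w <= 0 &
      `|w - z| <= C * (\sum_b `|F b z| + \sum_(i | Q i) Num.max (g i z) 0)].
Proof.
move=> F1 g1 Fz0 gz0 Ft Fd0 gd0.
(* [M] is the large factor of [d0]: the double sum bounds the change of any g i along the sign part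
   of the direction, so the total rate is at most (M - 1) - M = -1. *)
pose M : R := 1 + \sum_i \sum_b `|dot (gradient (g i) z0) (t b)|.
pose D : R := 1 + (\sum_b `|t b| + M * `|d0|).
pose m : R := #|{: B + I}|%:R.
have M0 : 0 <= M by rewrite addr_ge0// sumr_ge0// => i _; rewrite sumr_ge0.
have D0 : 0 < D.
  by rewrite ltr_pwDl// addr_ge0 ?sumr_ge0// mulr_ge0.
have m0 : 0 <= m by exact: ler0n.
(* The linearisation errors of the m residuals add up to at most m e D s <= s/2. A step of length at
   most s D thus still gains s/2, which is descent at rate 1/(2 D). *)
pose e := 1 / (2 * D * (m + 1)).
have e0 : 0 < e by rewrite divr_gt0// !mulr_gt0// ltr_wpDl.
have eD : m * (e * D) <= 1 / 2.
  have -> : e * D = (2 * (m + 1))^-1.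
    by rewrite /e; field; rewrite !gt_eqF// ltr_wpDl.
  by rewrite ler_pdivrMr; [lra|rewrite mulr_gt0// ltr_wpDl].
have [r1 r10 Fe] := C1_strict_family z0 F1 e0.
have [r2 r20 ge] := C1_strict_family z0 g1 e0.
pose p (k : B + I) x : R := match k with
  | inl b => `|F b x| | inr i => if Q i then Num.max (g i x) 0 else 0 end.
have pE x : \sum_k p k x = \sum_b `|F b x| + \sum_(i | Q i) Num.max (g i x) 0.
  by rewrite big_sumType/= [X in _ = _ + X]big_mkcond.
have p0 k x : 0 <= p k x.
  by case: k => [b|i]//=; case: ifP => // _; rewrite le_max lexx orbT.
have cp : continuous (fun x => \sum_k p k x).
  apply: continuous_big => [|[b|i] _]; first exact: add_continuous.
    move=> x; apply: (@continuous_comp _ _ _ (F b) (fun y => `|y|)).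
      exact: C1_continuous.
    exact: norm_continuous.
  rewrite /p; case: (Q i); last by move=> x; exact: cst_continuous.
  apply: (@max_fun_continuous _ _ R (g i) (cst 0)); first exact: C1_continuous.
  exact: cst_continuous.
(* This is 2/c for the rate c = 1/(2 D). It is fixed before [U], since [crsc_error_bound] chooses
   its [U] in terms of it. *)
exists (2 / (1 / (2 * D))); first by rewrite !divr_gt0 ?mulr_gt0.
move=> U /near_normP[r3 r30 Ur]; pose r := Num.min r3 (Num.min r1 r2).
have r0 : 0 < r by rewrite !lt_min r30 r10.
have c0 : 0 < 1 / (2 * D) by rewrite divr_gt0 ?mulr_gt0.
have r20' : 0 < r / 2 by rewrite divr_gt0.
apply: filterS (descent_to_zero cp _ _ c0 r20' _).
- move=> z [w [/eqP pw wr wz]]; move: pw; rewrite -!pE psumr_eq0// => /allP pw.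
  have rr3 : r <= r3 by rewrite ge_min lexx.
  exists w; split=> // [|b|i Qi]; first by apply: Ur; lra.
    by have := pw (inl b) (mem_index_enum _); rewrite /= normr_eq0 => /eqP.
  have := pw (inr i) (mem_index_enum _); rewrite /= Qi => /eqP <-.
  by rewrite le_max lexx.
- by move=> x; rewrite sumr_ge0.
- apply: big1 => -[b|i] _ /=; first by rewrite Fz0 normr0.
  by case: ifP => // Qi; rewrite max_r// gz0.
move=> u ur pu.
pose d := - \sum_b Num.sg (F b u) *: t b + M *: d0.
have dD : `|d| <= D.
  rewrite ler_wpDl// (le_trans (ler_normD _ _))//; apply: lerD.
    rewrite normrN (le_trans (ler_norm_sum _ _ _))//; apply: ler_sum => b _.
    by rewrite normrZ normr_sg ler_piMl// lern1 leq_b1.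
  by rewrite normrZ ger0_norm.
have Fd b : dot (gradient (F b) z0) d = - Num.sg (F b u).
  rewrite dotDr dotZr Fd0 mulr0 addr0 dotNr dot_sumr (bigD1 b)//= big1.
    by rewrite addr0 dotZr Ft eqxx mulr1.
  by move=> c cb; rewrite dotZr Ft eq_sym (negPf cb) mulr0.
have gd i : Q i -> dot (gradient (g i) z0) d <= - 1.
  move=> Qi; rewrite dotDr dotZr dotNr dot_sumr.
  have le1 : `|\sum_b dot (gradient (g i) z0) (Num.sg (F b u) *: t b)| <= M - 1.
    rewrite /M addrAC subrr add0r (bigD1 i)//= ler_wpDr//.
      by rewrite sumr_ge0// => j _; rewrite sumr_ge0.
    rewrite (le_trans (ler_norm_sum _ _ _))//; apply: ler_sum => b _.
    by rewrite dotZr normrM normr_sg ler_piMl// lern1 leq_b1.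
  have := ler_wpM2l M0 (gd0 i Qi); move: le1; rewrite ler_norml => /andP[].
  rewrite mulrN1; lra.
have [s1 s10 s1p] : exists2 a : R, 0 < a & forall k, 0 < p k u -> a <= p k u.
  apply: uniform_radius => [k a b /andP[_ ba] pa pk|k].
    by rewrite (le_trans ba)// pa.
  have [pk|] := ltP 0 (p k u); last by exists 1.
  by exists (p k u).
(* Being below every positive residual, [s] does not overshoot zero to first order; the second bound
   keeps v within r of z0. *)
pose s := Num.min s1 (r / (2 * D) / 2).
have s0 : 0 < s by rewrite lt_min s10 !divr_gt0 ?mulr_gt0.
have sp k : 0 < p k u -> s <= p k u.
  by move=> /s1p; apply: le_trans; rewrite ge_min lexx.
have sD : s * D <= r / 4.
  have h : s <= r / (2 * D) / 2 by rewrite ge_min lexx orbT.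
  apply: le_trans (ler_wpM2r (ltW D0) h) _; rewrite le_eqVlt; apply/orP; left.
  by apply/eqP; field; rewrite gt_eqF.
pose v := u + s *: d.
have vu : v - u = s *: d by rewrite /v addrAC subrr add0r.
have nvu : `|v - u| <= s * D.
  by rewrite vu normrZ gtr0_norm// ler_pM2l.
have vr : `|v - z0| < r.
  rewrite -(subrK u v) -addrA (le_lt_trans (ler_normD _ _))//; lra.
have {ur}ur : `|u - z0| < r by lra.
move: vr ur; rewrite !lt_min => /andP[_ /andP[vr1 vr2]] /andP[_ /andP[ur1 ur2]].
have eh : e * `|v - u| <= e * D * s by rewrite -mulrA ler_pM2l// mulrC.
have h0 : 0 <= e * D * s by rewrite ltW// (mulr_gt0 (mulr_gt0 e0 D0) s0).
clearbody v s d e.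
have pv k : p k v <= p k u - s * (0 < p k u)%R%:R + e * D * s.
  case: k (sp k) => [b|i]; rewrite /p.
    have := le_trans (Fe b v u vr1 ur1) eh.
    rewrite vu dotZr Fd normr_gt0 => /[swap].
    have [->|Fb|Fb] := sgrP (F b u).
    - by move=> _; rewrite /= mulr0n oppr0 !mulr0 !subr0 addr0 add0r.
    - rewrite !mulr1 mulrN1 opprK => /(_ isT) sF.
      by rewrite !ler_norml => /andP[h1 h2]; apply/andP; split; lra.
    - rewrite opprK !mulr1 => /(_ isT) sF.
      by rewrite !ler_norml => /andP[h1 h2]; apply/andP; split; lra.
  case: ifP => [Qi|_ _]; last by rewrite ltxx mulr0n mulr0 subr0 add0r.
  have := le_trans (ge i v u vr2 ur2) eh; rewrite vu dotZr ler_norml.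
  have := gd i Qi; rewrite -(ler_pM2l s0) => h1 /andP[_ h2].
  rewrite lt_max ltxx orbF; have [gu|gu] := ltP 0 (g i u).
    by move=> /(_ isT) sg; rewrite mulr1n mulr1 ge_max; apply/andP; split; lra.
  by move=> _; rewrite mulr0n mulr0 ge_max; apply/andP; split; lra.
have := sumr_decrease (fun k => p0 k u) pu (ltW s0) pv.
rewrite -/m.
have : m * (e * D * s) <= 1 / 2 * s by rewrite mulrA ler_pM2r.
move=> h1 h2; have {h1 h2}pvu : \sum_k p k v <= \sum_k p k u - s / 2 by lra.
exists v; first lra.
have : 1 / (2 * D) * `|v - u| <= s / 2; last lra.
by rewrite mul1r mulrC ler_pdivrMr ?mulr_gt0//; lra.
Qed.

End Regularity.

(** * Constant rank and a persistent basis of gradients *)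

Section ConstantRank.
Context {R : realType} {n : nat}.

(** The dual vectors [t] are the columns of a right inverse of the matrix formed by a maximal
    independent set of rows. *)
Lemma subfamily_basis (K : finType) (v : K -> 'rV[R]_n) :
  exists (r : nat) (b : 'I_r -> K) (t : 'I_r -> 'rV[R]_n),
    (forall i j, dot (v (b i)) (t j) = (i == j)%:R) /\
    (forall k, exists a : 'I_r -> R, v k = \sum_i a i *: v (b i)).
Proof.
pose A : 'M[R]_(#|K|, n) := \matrix_i v (enum_val i).
pose f := maxrankfun A.
have /row_freeP[T AT] : row_free (rowsub f A) by exact: maxrowsub_free.
exists (\rank A), (fun i => enum_val (f i)), (fun j => (col j T)^T); split.
  move=> i j; have := congr1 (fun M : 'M[R]_(\rank A) => M i j) AT.
  rewrite !mxE => <-; by apply: eq_bigr => k _; rewrite !mxE.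
move=> k; have : (v k <= rowsub f A)%MS.
  rewrite eq_maxrowsub; have -> : v k = row (enum_rank k) A.
    by rewrite rowK enum_rankK.
  exact: row_sub.
case/submxP => a ->; exists (a 0); rewrite mulmx_sum_row.
by apply: eq_bigr => i _; rewrite row_rowsub rowK.
Qed.

(** Pairing a vanishing combination with t j bounds |c j| by e times the sum of all |c i|. Summing
    over the r indices gives a total at most e r < 1 times itself, so all coefficients vanish. *)
Lemma free_of_dual r (w t : 'I_r -> 'rV[R]_n) (e : R) : e * r%:R < 1 ->
    (forall i j, `|dot (w i) (t j) - (i == j)%:R| <= e) ->
  free [tuple w i | i < r].
Proof.
move=> er wt; apply/freeP => c.
under eq_bigr do rewrite -tnth_nth tnth_mktuple.
move=> cw0.
have cj j : `|c j| <= \sum_i `|c i| * e.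
  have : c j = \sum_i c i * ((i == j)%:R - dot (w i) (t j)).
    under eq_bigr do rewrite mulrBr.
    rewrite big_split/= sumrN (bigD1 j)//= eqxx mulr1 big1 => [|i ij].
      under [X in _ - X]eq_bigr do rewrite -dotZl.
      by rewrite -dot_suml cw0 dotC dot0r subr0 addr0.
    by rewrite (negPf ij) mulr0.
  move=> {1}->; apply: le_trans (ler_norm_sum _ _ _) _; apply: ler_sum => i _.
  by rewrite normrM ler_wpM2l// distrC.
have : \sum_j `|c j| <= e * r%:R * \sum_i `|c i|.
  apply: le_trans (ler_sum _ (fun j _ => cj j)) _.
  rewrite sumr_const card_ord -mulr_suml -mulr_natr; lra.
have c0 : 0 <= \sum_i `|c i| by rewrite sumr_ge0.
move=> h; have : \sum_i `|c i| == 0.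
  by rewrite eq_le c0 andbT -(@pmulr_rle0 _ (1 - e * r%:R)) ?subr_gt0//; lra.
rewrite psumr_eq0// => /allP h0 i; have := h0 i (mem_index_enum _).
by rewrite /= normr_eq0 => /eqP.
Qed.

(** A basis chosen at z0 stays independent nearby, because approximate duality with the fixed [t] is
    an open condition. As the rank does not grow, the basis keeps spanning all gradients. *)
Lemma constant_rank_span (K : finType) (F : K -> 'rV[R]_n -> R) z0 (r0 : nat) :
    (forall k, continuously_differentiable (F k)) ->
    (\forall z \near z0,
       (\dim <<[seq gradient (F k) z | k : K]>>)%VS = r0) ->
  exists (r : nat) (b : 'I_r -> K) (t : 'I_r -> 'rV[R]_n),
    (forall i j, dot (gradient (F (b i)) z0) (t j) = (i == j)%:R) /\
    \forall z \near z0, forall k, exists a : 'I_r -> R,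
      gradient (F k) z = \sum_i a i *: gradient (F (b i)) z.
Proof.
move=> F1 rk; have [r [b [t [bt bv]]]] := subfamily_basis (fun k => gradient (F k) z0).
exists r, b, t; split=> //.
pose B z := [tuple gradient (F (b i)) z | i < r].
have BK z : (<<B z>> <= <<[seq gradient (F k) z | k : K]>>)%VS.
  apply/span_subvP => _ /mapP[i _ ->]; apply: memv_span.
  by apply/mapP; exists (b i); rewrite ?mem_enum.
pose e : R := (2 * (r%:R + 1))^-1.
have r1 : 0 < r%:R + 1 :> R by rewrite ltr_wpDl.
have e0 : 0 < e by rewrite invr_gt0 mulr_gt0.
have er : e * r%:R < 1 by rewrite mulrC ltr_pdivrMr ?mulr_gt0//; lra.
have near_free : \forall z \near z0, free (B z).
  have : \forall z \near z0, forall ij : 'I_r * 'I_r,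
    `|dot (gradient (F (b ij.1)) z0) (t ij.2) - dot (gradient (F (b ij.1)) z) (t ij.2)| < e.
    apply: near_forall => -[i j] /=.
    have cD : continuous (fun z => dot (gradient (F (b i)) z) (t j)).
      apply: continuous_big => [|k _]; first exact: add_continuous.
      move=> z; apply: (@continuousM _ _ (fun z => gradient (F (b i)) z 0 k));
        last exact: cst_continuous.
      rewrite (_ : (fun _ => _) = (fun z => 'D_(delta_mx 0 k) (F (b i)) z)).
        by have [_] := F1 (b i); apply.
      by apply/funext => x; rewrite mxE.
    by move/cvgr_dist_lt: (cD z0); apply.
  apply: filterS => z zb; apply: (free_of_dual (t := t) er) => i j.
  by rewrite -bt distrC ltW// (zb (i, j)).
have r0E : r0 = r.
  have /nbhs_singleton <- := rk; have /nbhs_singleton := near_free.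
  rewrite /free size_tuple => /eqP <-; congr (\dim _)%VS; apply/eqP.
  rewrite eqEsubv BK andbT; apply/span_subvP => _ /mapP[k _ ->].
  have [a ->] := bv k; apply: memv_suml => i _; apply: memvZ; apply: memv_span.
  by apply/mapP; exists i; rewrite ?mem_enum.
apply: filterS2 rk near_free => z rz fz k.
have /eqP BE : (<<B z>> == <<[seq gradient (F k) z | k : K]>>)%VS.
  move: fz; rewrite /free size_tuple => /eqP fz.
  by rewrite eqEdim BK rz r0E fz /=.
have : gradient (F k) z \in <<B z>>%VS.
  by rewrite BE; apply: memv_span; apply/mapP; exists k; rewrite ?mem_enum.
move/coord_span => kE; exists (fun i => coord (B z) i (gradient (F k) z)).
by rewrite {1}kE; apply: eq_bigr => i _; rewrite -tnth_nth tnth_mktuple.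
Qed.

End ConstantRank.

(** * Functions whose gradients depend on those of a level set *)

Section LevelSets.
Context {R : realType} {n : nat}.
Implicit Types (z u v w x : 'rV[R]_n).

(** Along the level set through u each gradient of F b at u pairs with v - u to o(|v - u|), hence so
    does their combination. The radius [d] depends on u through the coefficients [a], for which no
    uniform bound is at hand. *)
Lemma dependent_gradient_level (B : finType) (F : B -> 'rV[R]_n -> R)
    (f : 'rV[R]_n -> R) u (a : B -> R) (e : R) :
    (forall b, continuously_differentiable (F b)) ->
    continuously_differentiable f ->
    gradient f u = \sum_b a b *: gradient (F b) u -> 0 < e ->
  exists2 d : R, 0 < d & forall v, `|v - u| < d ->
    (forall b, F b v = F b u) -> `|f v - f u| <= e * `|v - u|.
Proof.
move=> F1 f1 fu e0; pose A := \sum_b `|a b|.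
have A0 : 0 <= A by rewrite sumr_ge0.
have eA : 0 < e / (2 * (A + 1)) by rewrite divr_gt0// mulr_gt0// ltr_wpDl.
have e2 : 0 < e / 2 by rewrite divr_gt0.
have [d1 d10 FA] := C1_strict_family u F1 eA.
have [d2 d20 fA] := C1_strict u f1 e2.
exists (Num.min d1 d2); first by rewrite lt_min d10.
move=> v; rewrite lt_min => /andP[vd1 vd2] Fv.
have ud1 : `|u - u| < d1 by rewrite subrr normr0.
have ud2 : `|u - u| < d2 by rewrite subrr normr0.
have fb : `|dot (gradient f u) (v - u)| <= A * (e / (2 * (A + 1)) * `|v - u|).
  rewrite fu dot_suml mulr_suml (le_trans (ler_norm_sum _ _ _))//.
  apply: ler_sum => b _; rewrite dotZl normrM ler_wpM2l//.
  by have := FA b v u vd1 ud1; rewrite Fv subrr sub0r normrN.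
have {}fA := fA v u vd2 ud2.
have AA : A * (e / (2 * (A + 1)) * `|v - u|) <= e / 2 * `|v - u|.
  rewrite mulrA ler_wpM2r// mulrA ler_pdivrMr; last by rewrite mulr_gt0// ltr_wpDl.
  by rewrite mulrA divfK// mulrDr mulr1 mulrC lerDl ltW.
have := ler_distD (dot (gradient f u) (v - u)) (f v - f u) 0.
by rewrite !subr0; lra.
Qed.

(* The points [u] of the level set reachable from [w] at cost
   [|f u - f w| <= 2 e (|w - z0| - |u - z0|)] form a closed set whose point
   nearest to [z0] must be [z0] itself: otherwise step towards [z0] and correct
   back onto the level set. This replaces a C1 path inside the level set. *)
Lemma dependent_gradient_constant (B : finType) (F : B -> 'rV[R]_n -> R)
    (f : 'rV[R]_n -> R) z0 (t : B -> 'rV[R]_n) :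
    (forall b, continuously_differentiable (F b)) ->
    continuously_differentiable f ->
    (forall b, F b z0 = 0) -> f z0 = 0 ->
    (forall b c, dot (gradient (F b) z0) (t c) = (b == c)%:R) ->
    (\forall z \near z0, exists a : B -> R,
       gradient f z = \sum_b a b *: gradient (F b) z) ->
  \forall w \near z0, (forall b, F b w = 0) -> f w = 0.
Proof.
move=> F1 f1 Fz0 fz0 Ft /near_normP[r1 r10 fa].
have [C C0 /near_normP[r2 r20 FC]] : exists2 C : R, 0 < C & \forall z \near z0,
    exists2 w, (forall b, F b w = 0) & `|w - z| <= C * \sum_b `|F b z|.
  (* With an empty set of inequalities and direction 0, the bound becomes an estimate of the
     distance to the level set of F. *)
  have [|||||b||C C0 /(_ xpredT) FC] := @mfcq_error_bound R n B B xpred0 F F z0 t 0 => //.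
  by rewrite dot0r.
  exists C => //; apply: filterS (FC _) => [z [w [_ Fw _]]|].
    by rewrite big_pred0_eq addr0; exists w.
  by apply/near_normP; exists 1.
pose m : R := #|B|%:R.
have m0 : 0 <= m by exact: ler0n.
(* Chosen so that the correction back to the level set costs at most 2 C m e <= 1/3 of the step
   towards z0. *)
pose e := (6 * (C * m + 1))^-1.
have Cm1 : 0 < C * m + 1 by rewrite ltr_wpDl// mulr_ge0// ltW.
have e0 : 0 < e by rewrite invr_gt0 mulr_gt0.
have Cme : C * m * e <= 1 / 6 by rewrite ler_pdivrMr ?mulr_gt0//; lra.
have [r3 r30 Fe] := C1_strict_family z0 F1 e0.
apply/near_normP; exists (Num.min r1 (Num.min r2 r3)); first by rewrite !lt_min r10 r20.
move=> w; rewrite !lt_min => /andP[w1 /andP[w2 w3]] Fw.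
clearbody e.
suff fw (eps : R) : 0 < eps -> `|f w| <= 2 * eps * `|w - z0|.
  apply/eqP; rewrite -normr_le0; apply/ler_addgt0Pl => eta eta0.
  rewrite addr0; pose eps := eta / (2 * (`|w - z0| + 1)).
  have w0 : 0 < `|w - z0| + 1 by rewrite ltr_wpDl.
  apply: le_trans (fw eps _) _; first by rewrite divr_gt0// mulr_gt0.
  rewrite (_ : _ * _ = eta * (`|w - z0| / (`|w - z0| + 1))); last first.
    by rewrite /eps; field; rewrite gt_eqF.
  apply: ler_piMr; first exact: ltW.
  by rewrite ler_pdivrMr// mul1r lerDl.
move=> eps0.
pose S := [set u | forall b, F b u = 0] `&`
  [set u | `|f u - f w| + 2 * eps * `|u - z0| <= 2 * eps * `|w - z0|].
have clS : closed S.
  apply: closedI.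
    rewrite (_ : [set _ | _] = \bigcap_(b in [set: B]) (F b @^-1` [set 0])).
      apply: closed_bigI => b _; apply: closed_comp; last exact: closed_eq.
      by move=> x _; exact: (C1_continuous (F1 b)).
    by apply/seteqP; split => x /= Fx b; [move=> _|]; exact: Fx.
  apply: (@closed_comp _ _ (fun u => `|f u - f w| + 2 * eps * `|u - z0|)
    [set y | y <= 2 * eps * `|w - z0|]); last exact: closed_le.
  move=> x _; apply: (@continuousD _ _ _ (fun u => `|f u - f w|)
    (fun u => 2 * eps * `|u - z0|) x).
    apply: (@continuous_comp _ _ _ (fun u => f u - f w) (fun y => `|y|));
      last exact: norm_continuous.
    apply: (@continuousB _ _ _ f (cst (f w)) x); last exact: cst_continuous.
    exact: C1_continuous.
  apply: (@continuousM _ _ (cst (2 * eps)) (fun u => `|u - z0|) x).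
    exact: cst_continuous.
  exact: norm_sub_continuous.
have Sw : S w by split => //=; rewrite subrr normr0 add0r.
have Sbound u : S u -> `|u - z0| <= `|w - z0|.
  move=> [_ /= h]; rewrite -(@ler_pM2l _ (2 * eps)) ?mulr_gt0//.
  by have := normr_ge0 (f u - f w); lra.
have [u [Fu fu] umin] := closed_bounded_min (@norm_sub_continuous _ _ z0) clS Sbound Sw.
have uw := Sbound u (conj Fu fu).
have [u0|un0] := eqVneq (`|u - z0|) 0.
  move: u0 fu => /eqP; rewrite normr_eq0 subr_eq0 => /eqP -> /=.
  by rewrite subrr normr0 mulr0 addr0 fz0 sub0r normrN.
have {un0}u0 : 0 < `|u - z0| by rewrite lt_def un0 /=.
have [a fua] := fa u (le_lt_trans uw w1).
have [d d0 fd] := dependent_gradient_level F1 f1 fua eps0.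
(* s <= 1 keeps v on the segment from u to z0. The other bound gives |u' - u| <= (4/3)(d/2) < d, so
   that the level estimate at u applies to the corrected point u'. *)
pose s := Num.min 1 (d / (2 * `|u - z0|)).
have s0 : 0 < s by rewrite lt_min ltr01/= divr_gt0// mulr_gt0.
have s1 : s <= 1 by rewrite ge_min lexx.
have sd : s * `|u - z0| <= d / 2.
  rewrite -ler_pdivlMr//; apply: (@le_trans _ _ (d / (2 * `|u - z0|))).
    by rewrite ge_min lexx orbT.
  by rewrite invfM mulrA.
clearbody s; pose v := u + s *: (z0 - u).
have vz0 : `|v - z0| = (1 - s) * `|u - z0|.
  rewrite -[1 - s]ger0_norm ?subr_ge0// -normrZ; congr `|_|.
  by apply/rowP => j; rewrite !mxE; ring.
have vu : v - u = s *: (z0 - u) by rewrite /v addrAC subrr add0r.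
have nvu : `|v - u| = s * `|u - z0| by rewrite vu normrZ gtr0_norm// distrC.
have su0 : 0 < s * `|u - z0| by rewrite mulr_gt0.
have vw : `|v - z0| <= `|w - z0| by lra.
(* F b vanishes at both u and z0, so its derivative along z0 - u is small. Linearising from u to v
   adds the same error again, whence the factor 2. *)
have Fv b : `|F b v| <= 2 * (e * (s * `|u - z0|)).
  have z03 : `|z0 - z0| < r3 by rewrite subrr normr0.
  have u3 := le_lt_trans uw w3; have v3 := le_lt_trans vw w3.
  have := Fe b v u v3 u3; have := Fe b z0 u z03 u3.
  rewrite nvu vu dotZr Fu Fz0 subrr sub0r normrN distrC subr0.
  rewrite -(ler_pM2l s0) -{1}(gtr0_norm s0) -normrM => h1 h2.
  have := ler_distD (s * dot (gradient (F b) z0) (z0 - u)) (F b v) 0.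
  rewrite !subr0 => h3; apply: le_trans h3 _; apply: le_trans (lerD h2 h1) _.
  by rewrite mulrCA -mulr2n mulr_natl.
have [u' Fu' u'v] := FC v (le_lt_trans vw w2).
have {}u'v : `|u' - v| <= 1 / 3 * (s * `|u - z0|).
  apply: le_trans u'v _.
  apply: (@le_trans _ _ (C * (m * (2 * (e * (s * `|u - z0|)))))).
    rewrite ler_pM2l//; apply: le_trans (ler_sum _ (fun b _ => Fv b)) _.
    by rewrite sumr_const -[leLHS]mulr_natl.
  have := ler_wpM2r (ltW su0) Cme; lra.
(* The corrected step has length at most 4/3 of s |u - z0| and brings the point closer to z0 by at
   least 2/3 of it. The ratio 2 is the factor in the cost defining [S], so u' stays in [S] and
   contradicts minimality. *)
have u'u : `|u' - u| <= 4 / 3 * (s * `|u - z0|).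
  by have := ler_distD v u' u; lra.
have u'z0 : `|u' - z0| <= `|u - z0| - 2 / 3 * (s * `|u - z0|).
  by have := ler_distD v u' z0; lra.
have Su' : S u'.
  split => //=; have fu'u : `|f u' - f u| <= eps * `|u' - u|.
    by apply: fd => [|b]; [lra|rewrite Fu' Fu].
  have : eps * `|u' - u| <= eps * (2 * (`|u - z0| - `|u' - z0|)).
    by rewrite ler_pM2l//; lra.
  by have := ler_distD (f u) (f u') (f w); move: fu => /=; lra.
by have := umin _ Su'; lra.
Qed.

End LevelSets.

(** * Theorems of the alternative *)

Section Alternatives.
Context {R : realType} {n : nat}.

Lemma dot_self_ge0 (x : 'rV[R]_n) : 0 <= dot x x.
Proof. by apply: sumr_ge0 => j _; rewrite -expr2 sqr_ge0. Qed.

Lemma dot_self_eq0 (x : 'rV[R]_n) : dot x x = 0 -> x = 0.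
Proof.
move/eqP; rewrite psumr_eq0 => [/allP x0|j _]; last by rewrite -expr2 sqr_ge0.
apply/rowP => j; have := x0 j (mem_index_enum _).
by rewrite /= -expr2 sqrf_eq0 mxE => /eqP.
Qed.

(* The separating direction is the point of least Euclidean norm in the convex
   hull of the vectors. *)
Lemma gordan (N : nat) (v : 'I_N -> 'rV[R]_n) :
    (forall mu : 'I_N -> R, (forall i, 0 <= mu i) ->
      \sum_i mu i *: v i = 0 -> forall i, mu i = 0) ->
  exists d, forall i, dot (v i) d <= - 1.
Proof.
move=> vpos; case: (posnP N) => [N0|Npos].
  by exists 0 => i; have := ltn_ord i; rewrite {2}N0.
pose x (mu : 'rV[R]_N) := \sum_i mu 0 i *: v i.
pose S := [set mu : 'rV[R]_N | forall i, 0 <= mu 0 i] `&`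
          [set mu | dot mu (const_mx 1) = 1].
have sumE (mu : 'rV[R]_N) : dot mu (const_mx 1) = \sum_i mu 0 i.
  by apply: eq_bigr => i _; rewrite mxE mulr1.
have clS : closed S.
  apply: closedI.
    rewrite (_ : [set _ | _] = \bigcap_(i in [set: 'I_N])
        ((fun mu : 'rV[R]_N => mu 0 i) @^-1` [set y | 0 <= y])).
      apply: closed_bigI => i _; apply: closed_comp; last exact: closed_ge.
      by move=> mu _; exact: coord_continuous.
    by apply/seteqP; split => mu /= mu0 i; [move=> _|]; exact: mu0.
  apply: (@closed_comp _ _ (fun mu => dot mu (const_mx 1)) [set 1]).
    by move=> mu _; exact: dot_continuous.
  exact: closed_eq.
have Sbound mu : S mu -> `|mu - 0| <= 1.
  move=> [mu0 /=]; rewrite subr0 sumE => mu1.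
  rewrite -[leLHS]/(mx_norm mu) mx_normrE; apply: bigmax_le => // -[k i] _ /=.
  by rewrite ord1 ger0_norm// -mu1 (bigD1 i)//= lerDl sumr_ge0.
pose i0 := Ordinal Npos.
have S0 : S (delta_mx 0 i0).
  split=> [i /=|/=]; first by rewrite mxE ler0n.
  rewrite sumE (bigD1 i0)//= big1 ?addr0 ?mxE ?eqxx// => i ii0.
  by rewrite mxE eqxx (negPf ii0).
have cx : continuous (fun mu => dot (x mu) (x mu)).
  apply: continuous_big => [|j _]; first exact: add_continuous.
  have cxj : continuous (fun mu => x mu 0 j).
    rewrite (_ : (fun _ => _) = fun mu => dot mu (\row_i v i 0 j)).
      exact: dot_continuous.
    by apply/funext => mu; rewrite summxE; apply: eq_bigr => i _; rewrite !mxE.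
  by move=> mu; apply: (@continuousM _ _ (fun mu => x mu 0 j) (fun mu => x mu 0 j));
    exact: cxj.
have [u [u0 /=]] := closed_bounded_min cx clS Sbound S0.
rewrite sumE => u1 umin.
have xx0 : 0 < dot (x u) (x u).
  rewrite lt_def dot_self_ge0 andbT; apply/eqP => /dot_self_eq0 xu0.
  have := vpos (u 0) u0 xu0 => u00.
  by move: u1; rewrite big1 => [/esym/eqP|i _]; rewrite ?oner_eq0// u00.
have xv i : dot (x u) (x u) <= dot (x u) (v i).
  rewrite leNgt; apply/negP => lti.
  pose c := dot (x u) (x u) - dot (x u) (v i).
  pose b := dot (v i - x u) (v i - x u).
  have c0 : 0 < c by rewrite subr_gt0.
  have b0 : 0 <= b by exact: dot_self_ge0.
  (* Moving by s towards vertex i turns the squared Euclidean norm of x u into itself minus 2 s c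
     plus s^2 b, and s b <= c makes this strictly smaller. *)
  pose s := Num.min 1 (c / (b + 1)).
  have s0 : 0 < s by rewrite lt_min ltr01 divr_gt0// ltr_wpDl.
  have s1 : s <= 1 by rewrite ge_min lexx.
  have sb : s * b <= c.
    have h : s <= c / (b + 1) by rewrite ge_min lexx orbT.
    apply: le_trans (ler_wpM2r b0 h) _.
    by rewrite mulrAC ler_pdivrMr ?ltr_wpDl// ler_pM2l// lerDl.
  pose mu := u + s *: (delta_mx 0 i - u).
  have Smu : S mu.
    split=> [k /=|/=].
      rewrite !mxE eqxx /=; have := u0 k; have h : 0 <= (k == i)%:R :> R by exact: ler0n.
      have -> : u 0 k + s * ((k == i)%:R - u 0 k) =
        s * (k == i)%:R + (1 - s) * u 0 k by ring.
      by move=> uk; rewrite addr_ge0// mulr_ge0// ?subr_ge0// ltW.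
    rewrite /mu dotDl dotZl dotDl dotNl sumE u1.
    have -> : dot (delta_mx 0 i) (const_mx 1) = 1 :> R.
      rewrite sumE (bigD1 i)//= big1 ?addr0 ?mxE ?eqxx// => k ki.
      by rewrite mxE eqxx (negPf ki).
    by rewrite subrr mulr0 addr0.
  have xmu : x mu = x u + s *: (v i - x u).
    rewrite /x /mu.
    have -> : v i = \sum_k (delta_mx 0 i : 'rV[R]_N) 0 k *: v k.
      rewrite (bigD1 i)//= big1 ?addr0 ?mxE ?eqxx ?scale1r// => k ki.
      by rewrite mxE eqxx (negPf ki) scale0r.
    rewrite -sumrB scaler_sumr -big_split/=; apply: eq_bigr => k _.
    by rewrite -scalerBl scalerA -scalerDl !mxE.
  have := umin _ Smu; rewrite xmu !dotDr !dotDl !dotZr !dotZl -/b.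
  rewrite (dotC (v i - x u) (x u)).
  have -> : dot (x u) (v i - x u) = - c by rewrite dotDr dotNr /c; ring.
  have : s * (s * b) <= s * c by rewrite ler_pM2l.
  have : 0 < s * c by rewrite mulr_gt0.
  clear; lra.
exists (- (dot (x u) (x u))^-1 *: x u) => i.
rewrite dotZr mulNr lerN2 dotC mulrC ler_pdivlMr// mul1r; exact: xv.
Qed.

(** Reduction to [gordan]: project each v i along the span of the w j by means of the dual t j.
    Correcting d by the t j makes it orthogonal to every w j, and its product with v i is then that
    of the uncorrected d with the projected vector. *)
Lemma motzkin (r : nat) (w t : 'I_r -> 'rV[R]_n) (I : finType) (Q : pred I)
    (v : I -> 'rV[R]_n) :
    (forall i j, dot (w i) (t j) = (i == j)%:R) ->
    (forall mu : I -> R, (forall i, Q i -> 0 <= mu i) ->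
      (exists a : 'I_r -> R, \sum_(i | Q i) mu i *: v i = \sum_j a j *: w j) ->
      forall i, Q i -> mu i = 0) ->
  exists d, (forall j, dot (w j) d = 0) /\ (forall i, Q i -> dot (v i) d <= - 1).
Proof.
move=> wt vpos.
pose v' i := v i - \sum_j dot (v i) (t j) *: w j.
pose A : {set I} := [set i | Q i]%SET.
have [|d dv] := @gordan #|A| (fun k => v' (enum_val k)).
  move=> mu mu0 mus k.
  pose nu i := \sum_l mu l * (enum_val l == i)%:R.
  have nuE l : nu (enum_val l) = mu l.
    rewrite /nu (bigD1 l)//= eqxx mulr1 big1 ?addr0// => k' kl.
    by rewrite (inj_eq enum_val_inj) (negPf kl) mulr0.
  rewrite -nuE; apply: vpos => [i _||]; first 1 last.
  - exists (fun j => \sum_l mu l * dot (v (enum_val l)) (t j)).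
    rewrite (eq_bigl (fun i => i \in A)) => [|i]; last by rewrite inE.
    rewrite big_enum_val/=; under eq_bigr do rewrite nuE.
    apply/eqP; rewrite -subr_eq0; apply/eqP; rewrite -[RHS]mus.
    under [X in _ - X]eq_bigr do rewrite scaler_suml.
    rewrite exchange_big/= -sumrB; apply: eq_bigr => l _.
    rewrite /v' scalerBr scaler_sumr; congr (_ - _).
    by apply: eq_bigr => j _; rewrite scalerA.
  - by have := enum_valP k; rewrite inE.
  by apply: sumr_ge0 => l _; rewrite mulr_ge0.
exists (d - \sum_j dot (w j) d *: t j); split=> [j|i Qi].
  rewrite dotDr dotNr dot_sumr (bigD1 j)//= big1 => [|k kj].
    by rewrite addr0 dotZr wt eqxx mulr1 subrr.
  by rewrite dotZr wt eq_sym (negPf kj) mulr0.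
have iA : i \in A by rewrite inE.
have := dv (enum_rank_in iA i); rewrite enum_rankK_in// /v' dotDl dotNl.
rewrite dotDr dotNr dot_suml dot_sumr.
under eq_bigr do rewrite dotZl mulrC -dotZr.
by [].
Qed.

End Alternatives.

(** * Positive dependence among active gradients *)

Section ActiveMinus.
Context {R : realType} {n : nat}.
Variables (P : nlp R n) (z0 : 'rV[R]_n).
Local Notation A := (active P z0).
Local Notation Am := (active_minus P z0).
Local Notation dg i := (gradient (nlp_ineq i) z0).
Local Notation dh j := (gradient (nlp_eq j) z0).
Implicit Types (mu : nlp_ineq_idx P -> R) (lambda : nlp_eq_idx P -> R).

Lemma active_minus_sub l : l \in Am -> l \in A.
Proof. by rewrite inE => /andP[]. Qed.

(** Together with [active_minus_elim] this replaces the definition, which singles out l, by a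
    nonnegative relation with positive weight at l. Such relations can be added. *)
Lemma active_minus_intro mu lambda l : l \in A ->
    (forall i, i \in A -> 0 <= mu i) -> 0 < mu l ->
    \sum_(i in A) mu i *: dg i + \sum_j lambda j *: dh j = 0 ->
  l \in Am.
Proof.
move=> lA mu0 mul; rewrite (big_setD1 l)//= => sum0.
rewrite inE lA /=; apply/asboolP.
exists (fun j => (mu l)^-1 * lambda j), (fun i => (mu l)^-1 * mu i); split.
  move=> i; rewrite inE => /andP[_ iA]; rewrite mulr_ge0 ?mu0//.
  by rewrite invr_ge0 ltW.
under eq_bigr do rewrite -scalerA.
under [X in _ + X]eq_bigr do rewrite -scalerA.
rewrite -!scaler_sumr -scalerDr -[LHS]scale1r -(@mulVf _ (mu l)) ?gt_eqF//.
rewrite -scalerA; congr (_ *: _); rewrite scalerN.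
by move/eqP: sum0; rewrite -addrA addr_eq0 => /eqP->; rewrite opprK addrC.
Qed.

Lemma active_minus_elim l : l \in Am -> exists mu lambda,
  [/\ forall i, i \in A -> 0 <= mu i, 0 < mu l &
      \sum_(i in A) mu i *: dg i + \sum_j lambda j *: dh j = 0].
Proof.
rewrite inE => /andP[lA /asboolP[lambda [mu [mu0 lE]]]].
exists (fun i => if i == l then 1 else mu i), lambda; split.
- by move=> i iA; case: ifPn => // il; apply: mu0; rewrite in_setD1 il.
- by rewrite eqxx.
rewrite (big_setD1 l)//= eqxx scale1r -[dg l]opprK lE.
rewrite [X in _ + X + _](eq_bigr (fun i => mu i *: dg i)) => [|i]; last first.
  by rewrite in_setD1 /= => /andP[/negPf ->].
by rewrite -addrA [X in _ + X]addrC addNr.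
Qed.

(** Add up one relation for each l in [active_minus]. An active index outside this set has weight 0
    in each of them, since a positive weight would put it in the set. *)
Lemma active_minus_balance : exists mu lambda,
  (forall i, i \in Am -> 0 < mu i) /\
  \sum_(i in Am) mu i *: dg i + \sum_j lambda j *: dh j = 0.
Proof.
have /choice[f fP] : forall l, exists ml : (nlp_ineq_idx P -> R) * (nlp_eq_idx P -> R),
    l \in Am -> [/\ forall i, i \in A -> 0 <= ml.1 i, 0 < ml.1 l &
      \sum_(i in A) ml.1 i *: dg i + \sum_j ml.2 j *: dh j = 0].
  move=> l; have [/active_minus_elim[mu [lambda h]]|_] := boolP (l \in Am).
    by exists (mu, lambda).
  by exists (fun=> 0, fun=> 0).
exists (fun i => \sum_(l in Am) (f l).1 i), (fun j => \sum_(l in Am) (f l).2 j).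
split=> [i iAm|].
  rewrite (bigD1 i)//= ltr_pwDl//; first by have [] := fP i iAm.
  apply: sumr_ge0 => l /andP[lAm _]; have [h _ _] := fP l lAm.
  exact/h/active_minus_sub.
under eq_bigr do rewrite scaler_suml.
under [X in _ + X]eq_bigr do rewrite scaler_suml.
rewrite exchange_big [X in _ + X]exchange_big/= -big_split/=.
apply: big1 => l lAm; have [f0 fl fE] := fP l lAm.
rewrite -[RHS]fE; congr (_ + _).
rewrite [RHS](bigID (fun i => i \in Am))/= [X in _ = _ + X]big1 => [|i].
  rewrite addr0; apply: eq_bigl => i; apply/idP/andP => [iAm|[]//].
  by split=> //; exact: active_minus_sub.
move=> /andP[iA iAm]; have [->|fi0] := eqVneq ((f l).1 i) 0; first by rewrite scale0r.
case/negP: iAm; apply: (active_minus_intro iA f0 _ _); last first.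
  exact: fE.
by rewrite lt_def fi0 f0.
Qed.

(** A large multiple of the balancing relation makes the coefficients on [active_minus] nonnegative.
    A positive mu l would then put l in that set. This is the hypothesis [motzkin] asks for. *)
Lemma active_minus_independent mu nu lambda :
    (forall i, i \in A :\: Am -> 0 <= mu i) ->
    \sum_(i in A :\: Am) mu i *: dg i =
      \sum_(i in Am) nu i *: dg i + \sum_j lambda j *: dh j ->
  forall i, i \in A :\: Am -> mu i = 0.
Proof.
move=> mu0 muE l lAm; apply/eqP; rewrite eq_le mu0// andbT leNgt; apply/negP => mul.
have [c [kappa [c0 cE]]] := active_minus_balance.
pose M := \sum_(i in Am) `|nu i| / c i.
have Mc i : i \in Am -> 0 <= M * c i - nu i.
  move=> iAm; rewrite subr_ge0 -ler_pdivrMr ?c0// /M (bigD1 i)//=.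
  rewrite ler_wpDr//; last by rewrite ler_pM2r ?invr_gt0 ?c0// ler_norm.
  apply: sumr_ge0 => k /andP[kAm _].
  by rewrite divr_ge0// ltW// c0.
have : l \in Am; last by move: lAm; rewrite inE => /andP[/negPf ->].
pose rho i := if i \in Am then M * c i - nu i else mu i.
have lA : l \in A by move: lAm; rewrite inE => /andP[].
apply: (@active_minus_intro rho (fun j => M * kappa j - lambda j)) => // [i iA||].
- rewrite /rho; case: ifPn => [/Mc//|iAm].
  by apply: mu0; rewrite inE iAm.
- by rewrite /rho; move: (lAm); rewrite inE => /andP[/negPf ->].
rewrite (bigID (fun i => i \in Am))/=.
rewrite (eq_bigl (fun i => i \in Am)) => [|i]; last first.
  by apply/andP/idP => [[]//|iAm]; split=> //; exact: active_minus_sub.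
rewrite [X in _ + X + _](eq_bigl (fun i => i \in A :\: Am)) => [|i]; last first.
  by rewrite finset.in_setD andbC.
rewrite [X in _ + X + _](eq_bigr (fun i => mu i *: dg i)) => [|i]; last first.
  by rewrite /rho finset.in_setD => /andP[/negPf ->].
rewrite muE (eq_bigr (fun i => M *: (c i *: dg i) - nu i *: dg i)) => [|i iAm]; last first.
  by rewrite /rho iAm scalerBl scalerA.
under [X in _ + X]eq_bigr do rewrite scalerBl -scalerA.
have cancel (x y u w : 'rV[R]_n) : x - y + (y + u) + (w - u) = x + w.
  by rewrite [_ + (_ + u)]addrA subrK addrACA addrN addr0.
by rewrite !sumrB -!scaler_sumr cancel -scalerDr cE scaler0.
Qed.

End ActiveMinus.

(** * The error bound for one program under CRSC *)

Section ErrorBound.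
Context {R : realType} {n : nat}.

(** Every x l is bounded above by the violation. If x i is very negative, a nearly balanced sum with
    positive weights forces the other terms to compensate, which their upper bounds limit. *)
Lemma balanced_bound (I E : finType) (S : {set I}) (c x : I -> R)
    (lambda y : E -> R) (k : R) :
    (forall i, i \in S -> 0 < c i) ->
    `|\sum_(i in S) c i * x i + \sum_j lambda j * y j| <= k ->
  forall i, i \in S -> c i * `|x i| <=
    (\sum_(i in S) c i + \sum_j `|lambda j|) *
    (\sum_i Num.max (x i) 0 + \sum_j `|y j|) + k.
Proof.
move=> c0 cxk i iS; pose V := \sum_i Num.max (x i) 0 + \sum_j `|y j|.
pose L := \sum_(i in S) c i + \sum_j `|lambda j|; rewrite -/V -/L.
have max0 l : 0 <= Num.max (x l) 0 by rewrite le_max lexx orbT.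
have V0 : 0 <= V by rewrite addr_ge0// sumr_ge0.
have xV l : x l <= V.
  apply: (@le_trans _ _ (Num.max (x l) 0)); first by rewrite le_max lexx.
  by rewrite /V (bigD1 l)//= -addrA lerDl addr_ge0// sumr_ge0.
have yV j : `|y j| <= V.
  by rewrite /V [X in _ + X](bigD1 j)//= addrCA lerDl addr_ge0// sumr_ge0.
have cS l : l \in S -> 0 <= c l by move=> lS; rewrite ltW// c0.
have k0 : 0 <= k by apply: le_trans cxk.
have cV (Q : pred I) : \sum_(l in S | Q l) c l * x l <= \sum_(l in S | Q l) c l * V.
  by apply: ler_sum => l /andP[lS _]; rewrite ler_wpM2l// cS.
have lV : \sum_j lambda j * y j <= \sum_j `|lambda j| * V.
  apply: ler_sum => j _; apply: le_trans (ler_norm _) _.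
  by rewrite normrM ler_wpM2l.
have LV : L * V = c i * V + \sum_(l in S | l != i) c l * V + \sum_j `|lambda j| * V.
  by rewrite /L (bigD1 i)//= !mulrDl -!mulr_suml.
have cl0 : 0 <= \sum_(l in S | l != i) c l * V.
  by apply: sumr_ge0 => l /andP[lS _]; rewrite mulr_ge0// cS.
have l0 : 0 <= \sum_j `|lambda j| * V by apply: sumr_ge0 => j _; rewrite mulr_ge0.
have [x0|x0] := leP 0 (x i).
  by rewrite ger0_norm//; have := ler_wpM2l (cS i iS) (xV i); lra.
rewrite ltr0_norm//; have civ : 0 <= c i * V by rewrite mulr_ge0// cS.
move: cxk; rewrite (bigD1 i)//= ler_norml => /andP[cxk _].
by have /= := cV (fun l => l != i); lra.
Qed.

Lemma C1_cst (a : R) : continuously_differentiable (cst a : 'rV[R]_n -> R).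
Proof.
split=> [z|j z]; first exact: differentiable_cst.
rewrite (_ : (fun _ => _) = cst 0); first exact: cst_continuous.
by apply/funext => x; exact: derive_cst.
Qed.

Lemma gradient_cst (a : R) (z : 'rV[R]_n) : gradient (cst a) z = 0.
Proof. by apply/rowP => j; rewrite !mxE derive_cst. Qed.

Lemma crsc_error_bound (P : nlp R n) (z0 : 'rV[R]_n) :
    (forall i, continuously_differentiable (@nlp_ineq R n P i)) ->
    (forall j, continuously_differentiable (@nlp_eq R n P j)) ->
    (forall i, @nlp_ineq R n P i z0 <= 0) ->
    (forall j, @nlp_eq R n P j z0 = 0) -> crsc P z0 ->
  exists2 C : R, 0 < C & \forall z \near z0, exists w,
    [/\ forall i, @nlp_ineq R n P i w <= 0, forall j, @nlp_eq R n P j w = 0 &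
     `|w - z| <= C * (\sum_i Num.max (@nlp_ineq R n P i z) 0 +
                      \sum_j `|@nlp_eq R n P j z|)].
Proof.
move=> g1 h1 gz0 hz0 [r0 rk].
set A := active P z0; set Am := active_minus P z0 in rk *.
pose K := (nlp_ineq_idx P + nlp_eq_idx P)%type.
(* Inequalities outside [Am] become the zero constraint, so that [K] needs no
   subtype. *)
pose F (k : K) : 'rV[R]_n -> R := match k with
  | inl i => if i \in Am then nlp_ineq i else cst 0 | inr j => nlp_eq j end.
have F1 k : continuously_differentiable (F k).
  by case: k => [i|j] //=; case: ifP => // _; exact: C1_cst.
have Fz0 k : F k z0 = 0.
  case: k => [i|j] //=; case: ifP => // /active_minus_sub.
  by rewrite inE => /eqP.
have {}rk : \forall z \near z0, (\dim <<[seq gradient (F k) z | k : K]>>)%VS = r0.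
  apply: filterS rk => z <-; rewrite /gradient_rank; congr (\dim _)%VS.
  apply/eqP; rewrite eqEsubv; apply/andP; split; apply/span_subvP => x.
    case/mapP => -[i|j] _ ->; rewrite /F.
      case: ifPn => iAm; last by rewrite gradient_cst mem0v.
      apply: memv_span; rewrite mem_cat; apply/orP; left; apply/mapP.
      by exists i; rewrite ?mem_enum.
    apply: memv_span; rewrite mem_cat; apply/orP; right; apply/mapP.
    by exists j; rewrite ?mem_enum.
  rewrite mem_cat => /orP[] /mapP[i].
    rewrite mem_enum => iAm ->; apply: memv_span; apply/mapP.
    by exists (inl i); rewrite ?mem_enum//= iAm.
  move=> _ ->; apply: memv_span; apply/mapP.
  by exists (inr i); rewrite ?mem_enum.
have [r [b [t [bt bspan]]]] := constant_rank_span F1 rk.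
(* [active_minus_independent] speaks of all constraints in [Am] and all equalities, so a combination
   of basis gradients is regrouped by the constraint each basis index selects. *)
have combE (a : 'I_r -> R) : exists nu lambda,
    \sum_j a j *: gradient (F (b j)) z0 =
    \sum_(i in Am) nu i *: gradient (nlp_ineq i) z0 +
    \sum_j lambda j *: gradient (@nlp_eq R n P j) z0.
  exists (fun i => \sum_(l | b l == inl i) a l), (fun j => \sum_(l | b l == inr j) a l).
  rewrite (partition_big b xpredT)//= big_sumType/=; congr (_ + _).
    rewrite [RHS]big_mkcond/=; apply: eq_bigr => i _; rewrite -/K.
    rewrite (eq_bigr (fun l => a l *: gradient (F (inl i)) z0)) => [|l /eqP ->//].
    by rewrite -scaler_suml /F; case: ifP => // _; rewrite gradient_cst scaler0.
  apply: eq_bigr => j _; rewrite scaler_suml.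
  by apply: eq_bigr => l /eqP ->.
have [d [dF dg]] : exists d : 'rV[R]_n,
    (forall j, dot (gradient (F (b j)) z0) d = 0) /\
    (forall i, i \in A :\: Am -> dot (gradient (nlp_ineq i) z0) d <= - 1).
  apply: (motzkin (Q := fun i => i \in A :\: Am) bt) => mu mu0 [a aE].
  have [nu [lambda combaE]] := combE a.
  by apply: (active_minus_independent mu0); rewrite aE combaE.
have gzA i : i \in A :\: Am -> nlp_ineq i z0 <= 0 by move=> _; exact: gz0.
have [C C0 Cbound] := @mfcq_error_bound R n 'I_r (nlp_ineq_idx P)
  (fun i => i \in A :\: Am) (fun j => F (b j)) (@nlp_ineq R n P) z0 t d
  (fun j => F1 (b j)) g1 (fun j => Fz0 (b j)) gzA bt dF dg.
have [c [lambda [c0 cE]]] := active_minus_balance P z0.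
pose L := \sum_(i in Am) c i + \sum_j `|lambda j|.
pose L' := 1 + \sum_(i in Am) (L + 1) / c i.
have L0 : 0 <= L.
  by rewrite addr_ge0// sumr_ge0// => i iAm; rewrite ltW// c0.
have L'1 : 1 <= L'.
  rewrite /L' lerDl sumr_ge0// => i iAm.
  by apply: divr_ge0; [lra|rewrite ltW// c0].
pose q := r%:R * L'.
have q0 : 0 <= q by rewrite mulr_ge0//; lra.
pose e := (2 * (C * q + 1))^-1.
have Cq : 0 < C * q + 1 by rewrite ltr_wpDl// mulr_ge0// ltW.
have e0 : 0 < e by rewrite invr_gt0 mulr_gt0.
have Cqe : C * q * e <= 1 / 2 by rewrite ler_pdivrMr ?mulr_gt0//; lra.
have [r1 r10 Fe] := C1_strict_family z0 F1 e0.
(* What w must satisfy beyond the conclusion of [mfcq_error_bound]: the constraints outside the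
   basis vanish too, inactive inequalities hold, and w lies where the linearisation error is at most
   e. *)
pose U z := (forall k, (forall j, F (b j) z = 0) -> F k z = 0) /\
            (forall i, i \notin A -> nlp_ineq i z <= 0) /\ `|z - z0| < r1.
have nearU : \forall z \near z0, U z.
  have U1 : \forall z \near z0, forall k, (forall j, F (b j) z = 0) -> F k z = 0.
    apply: near_forall => k.
    apply: (@dependent_gradient_constant R n 'I_r (fun j => F (b j)) (F k) z0 t) => //.
    by apply: filterS bspan => z; apply.
  have U2 : \forall z \near z0, forall i, i \notin A -> nlp_ineq i z <= 0.
    apply: near_forall => i; have [iA|iA] := boolP (i \in A).
      by apply/near_normP; exists 1.
    have gi : 0 < - nlp_ineq i z0.
      by rewrite oppr_gt0 lt_def gz0 andbT eq_sym; move: iA; rewrite inE.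
    move/cvgr_dist_lt: (C1_continuous (g1 i) (x := z0)) => /(_ _ gi).
    by apply: filterS => z; rewrite ltr_norml => /andP[? _] _; lra.
  have U3 : \forall z \near z0, `|z - z0| < r1 by apply/near_normP; exists r1.
  by apply: filterS3 U1 U2 U3 => z ? ? ?; split.
have nearz : \forall z \near z0, `|z - z0| < r1 by apply/near_normP; exists r1.
exists (2 * C * (q + 1)); first by rewrite !mulr_gt0// ltr_wpDl.
apply: filterS2 nearz (Cbound U nearU) => z zr1 [w [[wF [wA wr1]] Fw gw wz]].
have {}wF k : F k w = 0 by exact: wF.
exists w; split=> [i|j|]; last 1 first.
- set V := \sum_i _ + _; pose s := `|w - z|.
  have Fapprox k : `|F k z - dot (gradient (F k) z0) (z - w)| <= e * s.
    by have := Fe k z w zr1 wr1; rewrite wF subr0 distrC [X in e * X]distrC.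
  have V0 : 0 <= \sum_i Num.max (@nlp_ineq R n P i z) 0.
    by rewrite sumr_ge0// => i _; rewrite le_max lexx orbT.
  have V1 : 0 <= \sum_j `|@nlp_eq R n P j z| by rewrite sumr_ge0.
  have VV0 : 0 <= V by exact: addr_ge0.
  have es0 : 0 <= e * s := mulr_ge0 (ltW e0) (normr_ge0 _).
  (* Every F k vanishes at w and the balancing relation cancels the linear parts, so only the
     linearisation errors between z and w remain. *)
  have bal : `|\sum_(i in Am) c i * nlp_ineq i z +
               \sum_j lambda j * nlp_eq j z| <= L * (e * s).
    have /(congr1 (fun x => dot x (z - w))) := cE.
    rewrite dotDl !dot_suml [RHS]dotC dot0r => dE.
    rewrite -[X in `|X|]subr0 -[X in `|_ - X|]dE opprD addrACA -!sumrB.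
    rewrite (le_trans (ler_normD _ _))//.
    rewrite /L mulrDl !mulr_suml; apply: lerD; apply: le_trans (ler_norm_sum _ _ _) _.
      apply: ler_sum => i iAm; rewrite dotZl -mulrBr normrM gtr0_norm ?c0//.
      apply: ler_wpM2l; first by rewrite ltW// c0.
      by have := Fapprox (inl i); rewrite /F/= iAm.
    apply: ler_sum => j _; rewrite dotZl -mulrBr normrM ler_wpM2l//.
    exact: (Fapprox (inr j)).
  have Fz k : `|F k z| <= L' * (V + e * s).
    have es : V + e * s <= L' * (V + e * s) by rewrite ler_peMl// !addr_ge0.
    case: k => [i|j] /=; last first.
      apply: le_trans es; rewrite /V (bigD1 j)//= addrCA -addrA lerDl.
      by rewrite !addr_ge0// sumr_ge0.
    case: ifPn => [iAm|_]; last by rewrite normr0 (le_trans _ es)// !addr_ge0.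
    have ci := c0 i iAm.
    have gi : `|nlp_ineq i z| <= (L + 1) / c i * (V + e * s).
      rewrite mulrAC ler_pdivlMr// mulrC.
      have := balanced_bound c0 bal iAm; rewrite -/L -/V.
      by clear -VV0 es0; lra.
    apply: le_trans gi _; rewrite ler_wpM2r ?addr_ge0//.
    rewrite /L' (bigD1 i)//= addrCA lerDl addr_ge0// sumr_ge0// => l /andP[lAm _].
    by apply: divr_ge0; [lra|rewrite ltW// c0].
  have X : \sum_j `|F (b j) z| <= q * (V + e * s).
    apply: le_trans (ler_sum _ (fun j _ => Fz (b j))) _.
    by rewrite sumr_const card_ord -[leLHS]mulr_natl mulrA.
  have wzX : s <= C * (q * (V + e * s) + V).
    apply: le_trans wz _; rewrite ler_pM2l//; apply: lerD => //.
    rewrite /V ler_wpDr// big_mkcond; apply: ler_sum => i _.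
    by case: ifP => // _; rewrite le_max lexx orbT.
  have s0 : 0 <= s by exact: normr_ge0.
  (* Absorption: in s <= C (q (V + e s) + V) the term C q e s is at most s/2, hence s <= 2 C (q + 1)
     V. *)
  have := ler_wpM2r s0 Cqe; rewrite -/s; lra.
- have [iA|/wA//] := boolP (i \in A); have [iAm|iAm] := boolP (i \in Am).
    by have := wF (inl i); rewrite /F iAm => ->.
  by apply: gw; rewrite finset.in_setD iAm.
- exact: (wF (inr j)).
Qed.

End ErrorBound.

(** * Components of vector constraints and comparison with an arbitrary norm *)

Section Norms.
Context {R : realType} {n : nat}.

Lemma C1_coord p (f : 'rV[R]_n -> 'rV[R]_p) (i : 'I_p) :
  continuously_differentiable f ->
  continuously_differentiable (fun z => f z 0 i).
Proof.
move=> [df cf]; split=> [z|j z].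
  apply: (@differentiable_comp _ _ _ _ f (fun y : 'rV[R]_p => y 0 i)) => //.
  exact: differentiable_coord.
rewrite (_ : (fun _ => _) = (fun y : 'rV[R]_p => y 0 i) \o
    (fun x => 'D_(delta_mx 0 j) f x)).
  by apply: continuous_comp; [exact: cf|exact: coord_continuous].
by apply/funext => x /=; rewrite derive_mx ?mxE//; exact: diff_derivable.
Qed.

Variables (N : 'rV[R]_n -> R) (N_norm : is_norm N).

Lemma is_norm_ge0 x : 0 <= N x.
Proof.
have N0 : N 0 = 0 by rewrite -(scale0r 0) norm_homogeneous// normr0 mul0r.
have := norm_triangle N_norm x (- x).
by rewrite subrr N0 -scaleN1r norm_homogeneous// normrN1 mul1r; lra.
Qed.

Lemma is_norm_le x : N x <= (\sum_(j < n) N (delta_mx 0 j)) * `|x|.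
Proof.
have -> : N x = N (\sum_(j < n) x 0 j *: delta_mx 0 j) by rewrite -row_sum_delta.
rewrite mulr_suml; elim/big_rec2: _ => [|j y v _ IH].
  by rewrite -(scale0r 0) norm_homogeneous// normr0 mul0r.
apply: le_trans (norm_triangle N_norm _ _) _; apply: lerD => //.
rewrite norm_homogeneous// mulrC; apply: ler_wpM2l; first exact: is_norm_ge0.
exact: coord_le_norm.
Qed.

Lemma dist_le (F : set 'rV[R]_n) z w : F w -> dist N F z <= N (z - w).
Proof.
move=> Fw; apply: ge_inf; last by exists w.
by exists 0 => _ [u _ <-]; exact: is_norm_ge0.
Qed.

End Norms.

(** * From the branch programs to the switching constraints *)

Lemma branch_error_bound (R : realType) (n p q m : nat) (P : mpsc R n p q m)
    (z0 : 'rV[R]_n) (b1 b2 : {set 'I_m}) :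
    mpsc_continuously_differentiable P -> mpsc_feasible P z0 ->
    (b1, b2) \in bipartitions (I_GH P z0) -> crsc (branch_nlp P z0 b1 b2) z0 ->
  exists2 C : R, 0 < C & \forall z \near z0, exists2 w, mpsc_feasible P w &
    `|w - z| <= C * (\sum_(i < p) Num.max (mpsc_g P z 0 i) 0 +
      (\sum_(j < q) `|mpsc_h P z 0 j| +
       (\sum_(i in I_G P z0 :|: b1) `|mpsc_G P i z| +
        \sum_(i in I_H P z0 :|: b2) `|mpsc_H P i z|))).
Proof.
move=> [_ g1 h1 G1 H1] [gz hz GHz]; rewrite inE /= => /andP[_ /eqP b12] b_crsc.
have Gz i : i \in I_G P z0 :|: b1 -> mpsc_G P i z0 = 0.
  rewrite !inE => /orP[/andP[/eqP]//|ib].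
  have : i \in I_GH P z0 by rewrite -b12 inE ib.
  by rewrite inE => /andP[/eqP].
have Hz i : i \in I_H P z0 :|: b2 -> mpsc_H P i z0 = 0.
  rewrite !inE => /orP[/andP[_ /eqP]//|ib].
  have : i \in I_GH P z0 by rewrite -b12 inE ib orbT.
  by rewrite inE => /andP[_ /eqP].
have [||||C C0 CP] := crsc_error_bound _ _ _ _ b_crsc.
- by move=> i; exact: C1_coord.
- by case=> [j|[i|i]] /=; [exact: C1_coord|exact: G1|exact: H1].
- exact: gz.
- case=> [j|[i|i]] /=; first exact: hz.
    exact/Gz/valP.
  exact/Hz/valP.
exists C => //; apply: filterS CP => z [w [gw hw wz]]; exists w.
  split=> [i|j|i]; [exact: gw i|exact: hw (inl j)|].
  (* One of G i, H i vanishes at z0, so i belongs to the G-indices or the H-indices of the branch. A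
     branch-feasible point therefore kills a factor of each product. *)
  have [iG|iG] := boolP (i \in I_G P z0 :|: b1).
    by have /= -> := hw (inr (inl (exist _ i iG))); rewrite mul0r.
  have iH : i \in I_H P z0 :|: b2.
    move: iG; rewrite 2!finset.in_setU !negb_or => /andP[iG ib1].
    have [iGH|iGH] := boolP (i \in I_GH P z0).
      by move: iGH; rewrite -b12 finset.in_setU (negPf ib1) /= => ->; rewrite orbT.
    move/eqP: (GHz i); rewrite mulf_eq0; move: iG iGH; rewrite !inE.
    by case: (_ == 0); case: (_ == 0).
  by have /= -> := hw (inr (inr (exist _ i iH))); rewrite mulr0.
move: wz; rewrite big_sumType/= big_sumType/=.
by rewrite -(big_sub _ (fun i => `|mpsc_G P i z|)) -(big_sub _ (fun i => `|mpsc_H P i z|)).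
Qed.

Theorem theorem5p1 (R : realType) (n p q m : nat) (P : mpsc R n p q m)
  (P_C1 : mpsc_continuously_differentiable P)
  (N : 'rV[R]_n -> R) (N_norm : is_norm N)
  (zstar : 'rV[R]_n) (zstar_feasible : mpsc_feasible P zstar)
  (zstar_crsc : mpsc_piecewise_crsc P zstar) :
  mpsc_local_error_bound P N zstar.
Proof.
have [_ g1 h1 G1 H1] := P_C1; have [gz hz GHz] := zstar_feasible.
pose T := ({set 'I_m} * {set 'I_m})%type.
pose viol (b : T) z : R := \sum_(i < p) Num.max (mpsc_g P z 0 i) 0 +
  (\sum_(j < q) `|mpsc_h P z 0 j| +
   (\sum_(i in I_G P zstar :|: b.1) `|mpsc_G P i z| +
    \sum_(i in I_H P zstar :|: b.2) `|mpsc_H P i z|)).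
(* Membership in [bipartitions] is moved inside the neighbourhood and C is 1 for other pairs, so
   that a single function C on all pairs can be chosen and summed. *)
have /choice[C CP] : forall b : T, exists C : R, 0 < C /\
    (\forall z \near zstar, b \in bipartitions (I_GH P zstar) ->
      exists2 w, mpsc_feasible P w & `|w - z| <= C * viol b z).
  move=> [b1 b2]; have [b12|b12] := boolP ((b1, b2) \in bipartitions (I_GH P zstar)).
    have [C C0 CP] := branch_error_bound P_C1 zstar_feasible b12 (zstar_crsc b1 b2 b12).
    by exists C; split=> //; apply: filterS CP => z h _.
  by exists 1; split=> //; apply/near_normP; exists 1.
(* For an index that is not biactive, the member vanishing at zstar is the smaller one nearby, so
   the minimum in the residual is the member constrained by every branch. *)
have near_dominant (f g : 'rV[R]_n -> R) : continuously_differentiable f ->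
    continuously_differentiable g -> f zstar = 0 -> g zstar != 0 ->
    \forall z \near zstar, `|f z| <= `|g z|.
  move=> f1 g1' f0 g0; have g2 : 0 < `|g zstar| / 2 by rewrite divr_gt0// normr_gt0.
  move/cvgr_dist_lt: (C1_continuous f1 (x := zstar)) => /(_ _ g2).
  move/cvgr_dist_lt: (C1_continuous g1' (x := zstar)) => /(_ _ g2).
  apply: filterS2 => z; rewrite f0 sub0r normrN => gz' fz.
  by have := ler_distD (g z) (g zstar) 0; rewrite !subr0; lra.
have nearG : \forall z \near zstar, forall i, i \in I_G P zstar ->
    `|mpsc_G P i z| <= `|mpsc_H P i z|.
  apply: near_forall => i; have [|iG] := boolP (i \in I_G P zstar); last first.
    by apply/near_normP; exists 1.
  rewrite inE => /andP[/eqP Gi Hi].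
  by apply: filterS (near_dominant _ _ (G1 i) (H1 i) Gi Hi) => z h _.
have nearH : \forall z \near zstar, forall i, i \in I_H P zstar ->
    `|mpsc_H P i z| <= `|mpsc_G P i z|.
  apply: near_forall => i; have [|iH] := boolP (i \in I_H P zstar); last first.
    by apply/near_normP; exists 1.
  rewrite inE => /andP[Gi /eqP Hi].
  by apply: filterS (near_dominant _ _ (H1 i) (G1 i) Hi Gi) => z h _.
have nearC := near_forall (fun b => (CP b).2).
pose K := \sum_(j < n) N (delta_mx 0 j).
have K0 : 0 <= K by apply: sumr_ge0 => j _; exact: is_norm_ge0.
have C0 : 0 <= \sum_b C b by apply: sumr_ge0 => b _; rewrite ltW// (CP b).1.
(* The branch will depend on z, so its constant is replaced by the sum over all pairs. The added 1
   keeps alpha positive when n = 0, where K = 0. *)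
exists (K * (\sum_b C b) + 1); split; first by rewrite ltr_wpDl// mulr_ge0.
apply: filterS3 nearG nearH nearC => z zG zH zC.
set V := (X in _ <= _ * X).
pose b1 := [set i in I_GH P zstar | `|mpsc_G P i z| <= `|mpsc_H P i z|]%SET.
have b1E i : (i \in b1) =
    (i \in I_GH P zstar) && (`|mpsc_G P i z| <= `|mpsc_H P i z|) by rewrite inE.
pose b : T := (b1, I_GH P zstar :\: b1).
have b_bip : b \in bipartitions (I_GH P zstar).
  rewrite inE /=; apply/andP; split; first by
    rewrite -finset.setI_eq0 finset.setIDA finset.setDIl finset.setDv finset.set0I.
  apply/eqP/finset.setP => i; rewrite finset.in_setU finset.in_setD b1E.
  by case: (i \in _) => //=; rewrite andbT orbN.
have [w Fw wz] := zC b b_bip.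
(* For the branch adapted to z, the branch violation at z is exactly the MPSC residual: each index
   contributes its smaller member once. *)
have violV : viol b z = V.
  rewrite /viol /V -addrA; congr (_ + (_ + _)).
  have GH0 i : (mpsc_G P i zstar == 0) || (mpsc_H P i zstar == 0).
    by rewrite -mulf_eq0 GHz.
  rewrite [RHS](bigID (fun i => i \in I_G P zstar :|: b1))/=; congr (_ + _).
    apply: eq_bigr => i; rewrite finset.in_setU => /orP[/zG|] h.
      by rewrite min_l.
    by move: h; rewrite b1E => /andP[_ /min_l ->].
  apply: eq_big => [i|i].
    by rewrite !inE; move: (GH0 i); do 2!case: (_ == 0) => //=; rewrite andbT.
  rewrite finset.in_setU => /orP[/zH h|]; first by rewrite min_r.
  rewrite finset.in_setD b1E negb_and => /andP[/orP[/negPf ->//|]].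
  by rewrite -ltNge => /ltW/min_r ->.
have V0 : 0 <= V.
  apply: addr_ge0; [apply: addr_ge0|]; apply: sumr_ge0 => i _ //.
  by rewrite le_max lexx orbT.
apply: le_trans (dist_le N_norm z Fw) _.
apply: le_trans (is_norm_le N_norm _) _; rewrite -/K distrC.
apply: (@le_trans _ _ (K * (C b * V))).
  by rewrite ler_wpM2l// -violV.
apply: (@le_trans _ _ (K * (\sum_b C b) * V)).
  rewrite -mulrA ler_wpM2l// ler_wpM2r// (bigD1 b)//= lerDl.
  by apply: sumr_ge0 => b' _; rewrite ltW// (CP b').1.
by rewrite mulrDl mul1r lerDl.
Qed.
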